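(* $B$-translation is an embedding of $\mathbf{L_1}$ in $\mathbf{K4}$; that is, for every formula $\phi$ of $\mathbf{L_1}$, $\vdash_{\mathbf{L_1}}\phi$ if and only if $\vdash_{\mathbf{K4}}B(\phi)$.
   Context: The system $\mathbf{L_1}$ (Leśniewski's propositional ontology): fix a countably infinite set of name variables. The atomic formulas are exactly the expressions $\epsilon ab$ with $a,b$ name variables (possibly equal); formulas are built from atomic formulas by $\vee$ and $\neg$, the other connectives being the usual classical abbreviations. $\mathbf{L_1}$ is a Hilbert-style system of classical propositional logic (with modus ponens) over these formulas with the additional axiom schemata, for all name variables $a,b,c$: (Ax1) $\epsilon ab \supset \epsilon aa$; (Ax2) $(\epsilon ab \wedge \epsilon bc) \supset \epsilon ac$; (Ax3) $(\epsilon ab \wedge \epsilon bc) \supset \epsilon ba$. $B$-translation: to each name variable $a$ corresponds a propositional variable $p_a$, with distinct name variables corresponding to distinct propositional variables. $B$ maps formulas of $\mathbf{L_1}$ to propositional modal formulas by $B(\phi\vee\psi)=B(\phi)\vee B(\psi)$, $B(\neg\phi)=\neg B(\phi)$, $B(\epsilon ab)=p_a\wedge\Box(p_a\supset p_b)\wedge\bigl(p_b\supset\Box(p_b\supset p_a)\bigr)$. $\mathbf{K4}$ is $\mathbf{K}+\Box\phi\supset\Box\Box\phi$, i.e. the smallest normal modal logic (containing $\mathbf{K}$, closed under modus ponens, substitution and necessitation) containing this schema. *)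

(* Defs.v *)
From mathcomp Require Import all_boot.

Set Implicit Arguments.
Unset Strict Implicit.
Unset Printing Implicit Defensive.

Definition countably_infinite (T : Type) : Prop :=
  exists f : nat -> T, bijective f.

(* Classical propositional logic over any language with negation [neg] and
   disjunction [dis] as primitives. *)

Definition impl (F : Type) (neg : F -> F) (dis : F -> F -> F) (x y : F) : F :=
  dis (neg x) y.

Definition conj (F : Type) (neg : F -> F) (dis : F -> F -> F) (x y : F) : F :=
  neg (dis (neg x) (neg y)).

(* The Hilbert-Ackermann axiom schemata, complete for classical propositional
   logic with modus ponens when [impl x y] abbreviates [~ x \/ y]. *)
Inductive cpl_axiom (F : Type) (neg : F -> F) (dis : F -> F -> F) : F -> Prop :=
| cpl_idem x : cpl_axiom neg dis (impl neg dis (dis x x) x)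
| cpl_weak x y : cpl_axiom neg dis (impl neg dis x (dis x y))
| cpl_perm x y : cpl_axiom neg dis (impl neg dis (dis x y) (dis y x))
| cpl_sum x y z :
    cpl_axiom neg dis
      (impl neg dis (impl neg dis x y)
                    (impl neg dis (dis z x) (dis z y))).

Inductive l1_form (N : Type) : Type :=
| L1Eps (a b : N)
| L1Neg (x : l1_form N)
| L1Or (x y : l1_form N).

Definition l1_imp (N : Type) : l1_form N -> l1_form N -> l1_form N :=
  impl (@L1Neg N) (@L1Or N).

Definition l1_and (N : Type) : l1_form N -> l1_form N -> l1_form N :=
  conj (@L1Neg N) (@L1Or N).

Inductive L1_provable (N : Type) : l1_form N -> Prop :=
| L1_cpl x : cpl_axiom (@L1Neg N) (@L1Or N) x -> L1_provable x
| L1_ax1 a b : L1_provable (l1_imp (L1Eps a b) (L1Eps a a))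
| L1_ax2 a b c :
    L1_provable (l1_imp (l1_and (L1Eps a b) (L1Eps b c)) (L1Eps a c))
| L1_ax3 a b c :
    L1_provable (l1_imp (l1_and (L1Eps a b) (L1Eps b c)) (L1Eps b a))
| L1_mp x y : L1_provable (l1_imp x y) -> L1_provable x -> L1_provable y.

Inductive modal_form (P : Type) : Type :=
| MVar (p : P)
| MNeg (x : modal_form P)
| MOr (x y : modal_form P)
| MBox (x : modal_form P).

Definition m_imp (P : Type) : modal_form P -> modal_form P -> modal_form P :=
  impl (@MNeg P) (@MOr P).

Definition m_and (P : Type) : modal_form P -> modal_form P -> modal_form P :=
  conj (@MNeg P) (@MOr P).

Fixpoint m_subst (P : Type) (s : P -> modal_form P) (x : modal_form P)
  : modal_form P :=
  match x with
  | MVar p => s p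
  | MNeg y => MNeg (m_subst s y)
  | MOr y z => MOr (m_subst s y) (m_subst s z)
  | MBox y => MBox (m_subst s y)
  end.

Inductive K4_provable (P : Type) : modal_form P -> Prop :=
| K4_cpl x : cpl_axiom (@MNeg P) (@MOr P) x -> K4_provable x
| K4_K x y :
    K4_provable (m_imp (MBox (m_imp x y)) (m_imp (MBox x) (MBox y)))
| K4_4 x : K4_provable (m_imp (MBox x) (MBox (MBox x)))
| K4_mp x y : K4_provable (m_imp x y) -> K4_provable x -> K4_provable y
| K4_subst (s : P -> modal_form P) x :
    K4_provable x -> K4_provable (m_subst s x)
| K4_nec x : K4_provable x -> K4_provable (MBox x).

(* [p] assigns to each name variable its propositional variable. *)
Fixpoint B_translation (N P : Type) (p : N -> P) (x : l1_form N)
  : modal_form P :=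
  match x with
  | L1Eps a b =>
      let pa := MVar (p a) in
      let pb := MVar (p b) in
      m_and (m_and pa (MBox (m_imp pa pb)))
            (m_imp pb (MBox (m_imp pb pa)))
  | L1Neg y => MNeg (B_translation p y)
  | L1Or y z => MOr (B_translation p y) (B_translation p z)
  end.

(* Main.v *)
(** Soundness: the translations of the three axioms follow from instances of
    [K] alone.  Completeness: if [phi] is not provable in L1, then extending
    L1 by finitely many atoms or negated atoms gives a theory which decides
    every atom of [phi] and still omits [phi]; the relation
    [v a b := "the theory contains eps a b"] then satisfies the three axioms
    and refutes [phi].  From [v] one builds a Kripke model with an irreflexive
    root, where [p a] holds iff [v a a], which sees one terminal world for each
    name [c], where [p a] holds iff [v c a].  Then [B (eps a b)] holds at the
    root iff [v a b]: the world of [a] tests [v a b], and conversely the axioms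
    propagate [v a b] to every world. *)
Require Import Defs.
From mathcomp Require Import all_boot.
From Stdlib Require Import Classical.

Set Implicit Arguments.
Unset Strict Implicit.
Unset Printing Implicit Defensive.

(** * Propositional calculus in an arbitrary theory *)

Section ClassicalTheories.

Variables (F : Type) (neg : F -> F) (dis : F -> F -> F).

Local Notation "x ==>> y" := (impl neg dis x y)
  (at level 55, right associativity).

(** Covers both calculi and their extensions by hypotheses; the latter need not be closed under
    necessitation or substitution. *)
Record cpl_theory (T : F -> Prop) : Prop := CplTheory {
  cpl_theory_ax x : cpl_axiom neg dis x -> T x;
  cpl_theory_mp x y : T (x ==>> y) -> T x -> T y }.

(* With this definition the deduction theorem holds by conversion; its content
   is moved to [extend_theory]. *)
Definition extend (T : F -> Prop) (h : F) : F -> Prop := fun x => T (h ==>> x).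

Section Rules.

Variables (T : F -> Prop) (thT : cpl_theory T).

Let mp x y : T (x ==>> y) -> T x -> T y. Proof. exact: cpl_theory_mp. Qed.
Let ax x : cpl_axiom neg dis x -> T x. Proof. exact: cpl_theory_ax. Qed.

Lemma imp_trans x y z : T (x ==>> y) -> T (y ==>> z) -> T (x ==>> z).
Proof. by move=> xy yz; exact: mp (mp (ax (cpl_sum _ _ _ _ _)) yz) xy. Qed.

Lemma imp_refl x : T (x ==>> x).
Proof.
exact: imp_trans (ax (cpl_weak _ _ x x)) (ax (cpl_idem _ _ x)).
Qed.

Lemma dis_introl x y : T x -> T (dis x y).
Proof. exact: mp (ax (cpl_weak _ _ _ _)). Qed.

Lemma dis_comm x y : T (dis x y) -> T (dis y x).
Proof. exact: mp (ax (cpl_perm _ _ _ _)). Qed.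

Lemma dis_intror x y : T y -> T (dis x y).
Proof. by move=> Ty; exact/dis_comm/dis_introl. Qed.

Lemma imp_dis x y z : T (x ==>> z) -> T (y ==>> z) -> T (dis x y ==>> z).
Proof.
move=> xz yz.
have step1 := mp (ax (cpl_sum neg dis y z x)) yz.
have step2 := imp_trans step1 (ax (cpl_perm _ _ _ _)).
have step3 := imp_trans step2 (mp (ax (cpl_sum _ _ x z z)) xz).
exact: imp_trans step3 (ax (cpl_idem _ _ _)).
Qed.

Lemma dis_elim x y z : T (x ==>> z) -> T (y ==>> z) -> T (dis x y) -> T z.
Proof. by move=> xz yz; exact/mp/imp_dis. Qed.

Lemma imp_weaken x y : T y -> T (x ==>> y).
Proof. exact: dis_intror. Qed.

(** This carries the deduction theorem: exchanging the premises [h] and [x] and chaining with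
    [h ==>> x] gives [h ==>> h ==>> y], which is then contracted. *)
Lemma imp_mp h x y : T (h ==>> x ==>> y) -> T (h ==>> x) -> T (h ==>> y).
Proof.
move=> hxy hx.
have swap : T ((h ==>> x ==>> y) ==>> (x ==>> h ==>> y)).
  apply: imp_dis; last first.
    apply: mp (ax (cpl_sum _ _ _ _ _)) _.
    exact: imp_trans (ax (cpl_weak _ _ _ _)) (ax (cpl_perm _ _ _ _)).
  apply: imp_trans (ax (cpl_weak _ _ _ y)) _.
  exact: imp_trans (ax (cpl_weak _ _ _ _)) (ax (cpl_perm _ _ _ _)).
have hhy := imp_trans hx (mp swap hxy).
(* Contraction: [h ==>> h ==>> y] is a disjunction, and both disjuncts imply [h ==>> y]. *)
apply: mp hhy; apply: imp_dis; last exact: imp_refl.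
exact: ax (cpl_weak _ _ _ _).
Qed.

Lemma extend_theory h : cpl_theory (extend T h).
Proof. by split=> [x /ax /imp_weaken|x y]; [exact | exact: imp_mp]. Qed.

Lemma explode x y : T x -> T (neg x) -> T y.
Proof. by move=> Tx Tnx; apply: mp Tx; exact: dis_introl. Qed.

Lemma neg_intro x : T (x ==>> neg x) -> T (neg x).
Proof. exact: mp (ax (cpl_idem _ _ _)). Qed.

(** Excluded middle is [imp_refl x], since [x ==>> x] unfolds to [dis (neg x) x]. *)
Lemma by_cases x y : T (x ==>> y) -> T (neg x ==>> y) -> T y.
Proof. by move=> xy nxy; exact: dis_elim nxy xy (imp_refl x). Qed.

Lemma neg_neg_intro x : T x -> T (neg (neg x)).
Proof. exact: mp (dis_comm (imp_refl (neg x))). Qed.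

End Rules.

Lemma imp_of_extend (T : F -> Prop) h x : extend T h x -> T (h ==>> x).
Proof. by []. Qed.

Lemma extend_weaken (T : F -> Prop) h x : cpl_theory T -> T x -> extend T h x.
Proof. by move=> thT; exact: imp_weaken. Qed.

Lemma extend_self (T : F -> Prop) h : cpl_theory T -> extend T h h.
Proof. by move=> thT; exact: imp_refl. Qed.

Section ConjunctionRules.

Variables (T : F -> Prop) (thT : cpl_theory T).

Lemma neg_dis_intro x y : T (neg x) -> T (neg y) -> T (neg (dis x y)).
Proof.
have absurd z w : T (neg z) -> T (z ==>> w).
  move=> nz; apply: imp_of_extend.
  apply: (explode (extend_theory thT z) w (extend_self z thT)).
  exact: extend_weaken.
by move=> nx ny; apply: neg_intro => //; apply: imp_dis => //; exact: absurd.
Qed.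

Lemma conj_intro x y : T x -> T y -> T (conj neg dis x y).
Proof. by move=> Tx Ty; apply: neg_dis_intro; exact: neg_neg_intro. Qed.

Lemma conj_proj x y : T (conj neg dis x y) -> T x /\ T y.
Proof.
have elim z : T (conj neg dis x y) -> T (neg z ==>> dis (neg x) (neg y)) -> T z.
  move=> Tc nz; apply: (by_cases thT (x := z)); first exact: imp_refl.
  apply: imp_of_extend.
  apply: (explode (extend_theory thT (neg z)) z nz).
  exact: extend_weaken.
move=> Tc; split; apply: elim => //.
  exact: (dis_introl (extend_theory thT _) (neg y) (extend_self (neg x) thT)).
exact: (dis_intror (extend_theory thT _) (neg x) (extend_self (neg y) thT)).
Qed.

End ConjunctionRules.

End ClassicalTheories.

(** * Completeness of L1 for valuations satisfying its axioms *)

Section L1Completeness.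

Variable N : Type.

Local Notation theory := (cpl_theory (@L1Neg N) (@L1Or N)).
Local Notation extends := (extend (@L1Neg N) (@L1Or N)).

Fixpoint l1_eval (v : N -> N -> Prop) (x : l1_form N) : Prop :=
  match x with
  | L1Eps a b => v a b
  | L1Neg y => ~ l1_eval v y
  | L1Or y z => l1_eval v y \/ l1_eval v z
  end.

Fixpoint decides_atoms (T : l1_form N -> Prop) (x : l1_form N) : Prop :=
  match x with
  | L1Eps a b => T (L1Eps a b) \/ T (L1Neg (L1Eps a b))
  | L1Neg y => decides_atoms T y
  | L1Or y z => decides_atoms T y /\ decides_atoms T z
  end.

Lemma decides_atoms_mono (T T' : l1_form N -> Prop) x :
  (forall y, T y -> T' y) -> decides_atoms T x -> decides_atoms T' x.
Proof.
move=> TT'; elim: x => [a b|x IHx|x IHx y IHy] //=.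
  by case=> /TT'; [left | right].
by case=> /IHx ? /IHy.
Qed.

(** A finite Lindenbaum argument, by recursion on [x]: if adding an atom yields [phi], adding its
    negation cannot, or [T] would already contain [phi] by cases. *)
Lemma decides_atoms_extension phi x T : theory T -> ~ T phi ->
  exists T', [/\ theory T', forall y, T y -> T' y, ~ T' phi
               & decides_atoms T' x].
Proof.
elim: x T => [a b|x IHx|x IHx y IHy] T thT Tphi.
- have [Tab|nTab] := classic (extends T (L1Eps a b) phi).
    exists (extends T (L1Neg (L1Eps a b))); split.
    + exact: extend_theory.
    + by move=> y; exact: extend_weaken.
    + by move=> nab; apply: Tphi; exact (by_cases thT Tab nab).
    + by right; exact: extend_self.
  exists (extends T (L1Eps a b)); split => //.
  + exact: extend_theory.
  + by move=> y; exact: extend_weaken.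
  + by left; exact: extend_self.
- by have [T' [*]] := IHx T thT Tphi; exists T'.
- have [T1 [thT1 sub1 T1phi dec1]] := IHx T thT Tphi.
  have [T2 [thT2 sub2 T2phi dec2]] := IHy T1 thT1 T1phi.
  exists T2; split=> // [z /sub1 /sub2 //|].
  by split=> //; exact: decides_atoms_mono sub2 dec1.
Qed.

(** Truth lemma. Both halves go through one induction because negation exchanges them. *)
Lemma decides_atoms_eval T x : theory T -> decides_atoms T x ->
  (l1_eval (fun a b => T (L1Eps a b)) x -> T x) /\
  (~ l1_eval (fun a b => T (L1Eps a b)) x -> T (L1Neg x)).
Proof.
move=> thT; elim: x => [a b|x IHx|x IHx y IHy] /=.
- by case=> ?; split.
- case/IHx=> pos opp; split=> // nn.
  by apply: (neg_neg_intro thT); apply: pos; exact: NNPP.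
- case=> /IHx[posx oppx] /IHy[posy oppy]; split.
    case=> [/posx|/posy]; first exact: (dis_introl thT).
    exact: (dis_intror thT).
  move=> nxy; apply: (neg_dis_intro thT).
    by apply: oppx => ?; apply: nxy; left.
  by apply: oppy => ?; apply: nxy; right.
Qed.

Record l1_model (v : N -> N -> Prop) : Prop := L1Model {
  l1_model1 a b : v a b -> v a a;
  l1_model2 a b c : v a b -> v b c -> v a c;
  l1_model3 a b c : v a b -> v b c -> v b a }.

Lemma L1_theory : theory (@L1_provable N).
Proof. by split=> [x|x y]; [exact: L1_cpl | exact: L1_mp]. Qed.

Lemma L1_complete phi : (forall v, l1_model v -> l1_eval v phi) ->
  L1_provable phi.
Proof.
move=> valid; apply: NNPP => nphi.
have [T [thT sub nTphi dec]] :=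
  decides_atoms_extension phi L1_theory nphi.
(* [T] contains every instance of the axioms, so the model conditions hold for all names, not just
   those of [phi]. *)
apply/nTphi/(proj1 (decides_atoms_eval thT dec)); apply: valid; split.
- by move=> a b; apply: (cpl_theory_mp thT); exact/sub/L1_ax1.
- move=> a b c ab bc.
  by apply: (cpl_theory_mp thT) (conj_intro thT ab bc); exact/sub/L1_ax2.
- move=> a b c ab bc.
  by apply: (cpl_theory_mp thT) (conj_intro thT ab bc); exact/sub/L1_ax3.
Qed.

End L1Completeness.

(** * Soundness of K4 on transitive frames *)

Section Kripke.

Variables (P W : Type) (R : W -> W -> Prop).

Fixpoint forces (V : W -> P -> Prop) (w : W) (x : modal_form P) : Prop :=
  match x with
  | MVar q => V w q
  | MNeg y => ~ forces V w y
  | MOr y z => forces V w y \/ forces V w z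
  | MBox y => forall w', R w w' -> forces V w' y
  end.

Lemma forces_imp V w x y :
  forces V w (m_imp x y) <-> (forces V w x -> forces V w y).
Proof. by rewrite /=; tauto. Qed.

Lemma forces_and V w x y :
  forces V w (m_and x y) <-> forces V w x /\ forces V w y.
Proof. by rewrite /=; tauto. Qed.

Lemma forces_subst V s w x :
  forces V w (m_subst s x) <-> forces (fun w q => forces V w (s q)) w x.
Proof.
elim: x w => [q|x IHx|x IHx y IHy|x IHx] w //=.
- by rewrite IHx.
- by rewrite IHx IHy.
- by split=> H w' /H /IHx.
Qed.

(** The valuation is quantified inside the induction because the substitution rule changes it. *)
Lemma K4_sound x : (forall u v w, R u v -> R v w -> R u w) ->
  K4_provable x -> forall V w, forces V w x.
Proof.
move=> trR; elim=> {x} [x ax|x y|x|x y _ IHxy _ IHx|s x _ IHx|x _ IHx] V w.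
- by case: ax => * /=; tauto.
- apply/forces_imp => xy; apply/forces_imp => /= Hx w' ww'.
  by move/(_ w' ww')/forces_imp: xy; apply; exact: Hx.
- by apply/forces_imp => /= Hx u wu t ut; apply: Hx; exact: trR wu ut.
- by move/(_ V w)/forces_imp: IHxy; apply.
- exact/forces_subst.
- by move=> w' _; exact: IHx.
Qed.

End Kripke.

(** * The star-shaped countermodel *)

Section Countermodel.

Variables (N P : Type) (p : N -> P) (v : N -> N -> Prop).
Hypotheses (hp : injective p) (hv : l1_model v).

(* [None] is the root and [Some c] the terminal world of the name [c]. *)
Definition star_rel (w w' : option N) : Prop := w = None /\ w' <> None.

(** The default in [odflt a w] makes the root test [v a a], while [Some c] tests [v c a]. Variables
    outside the image of [p] are false everywhere. *)
Definition star_val (w : option N) (q : P) : Prop :=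
  exists2 a, q = p a & v (odflt a w) a.

Lemma star_valE w a : star_val w (p a) <-> v (odflt a w) a.
Proof. by split=> [[b /hp <-] //|]; exists a. Qed.

(** Vacuous in effect: a successor is never the root, so no two-step path exists. *)
Lemma star_rel_trans u w t : star_rel u w -> star_rel w t -> star_rel u t.
Proof. by move=> [-> _] [_ ?]. Qed.

Lemma star_box_imp a b :
  forces star_rel star_val None (MBox (m_imp (MVar (p a)) (MVar (p b)))) <->
  (forall c, v c a -> v c b).
Proof.
split=> [H c|H [c|] [_ //] _].
  have Rc : star_rel None (Some c) by [].
  by have [] := H _ Rc; rewrite /= !star_valE.
by rewrite /= !star_valE; have := H c; tauto.
Qed.

Lemma star_forces_B x :
  forces star_rel star_val None (B_translation p x) <-> l1_eval v x.
Proof.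
elim: x => [a b|x IHx|x IHx y IHy]; last 2 first.
- by rewrite /= IHx.
- by rewrite /= IHx IHy.
rewrite [B_translation _ _]/= !forces_and forces_imp !star_box_imp.
(* The boxed implication is used at the world of [a], where [aa] gives its premise. *)
rewrite /= !star_valE /=; split=> [[[aa ab] _]|ab]; first exact: ab.
split; first split.
- exact: l1_model1 ab.
- by move=> c ca; exact: l1_model2 ca ab.
(* [bb] serves as the second premise of Ax3, giving [v b a]. *)
- by move=> bb c cb; exact: l1_model2 cb (l1_model3 hv ab bb).
Qed.

End Countermodel.

(** * Derivability of the translated axioms *)

Section Soundness.

Variable P : Type.

Local Notation theory := (cpl_theory (@MNeg P) (@MOr P)).

Lemma K4_theory : theory (@K4_provable P).
Proof. by split=> [x|x y]; [exact: K4_cpl | exact: K4_mp]. Qed.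

Lemma K4_box_refl (x : modal_form P) : K4_provable (MBox (m_imp x x)).
Proof. exact/K4_nec/(imp_refl K4_theory). Qed.

Lemma K4_box_trans (x y z : modal_form P) :
  K4_provable (m_imp (MBox (m_imp x y))
                 (m_imp (MBox (m_imp y z)) (MBox (m_imp x z)))).
Proof.
apply: (imp_trans K4_theory) (K4_K _ _).
apply: K4_mp (K4_K _ _) _; apply: K4_nec.
apply: imp_of_extend; apply: imp_of_extend.
have thT1 := extend_theory K4_theory (m_imp x y).
apply: (imp_trans (extend_theory thT1 (m_imp y z))); last exact: extend_self.
by apply: extend_weaken => //; exact: (extend_self _ K4_theory).
Qed.

Definition B_eps (x y : modal_form P) : modal_form P :=
  m_and (m_and x (MBox (m_imp x y))) (m_imp y (MBox (m_imp y x))).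

Section K4Theory.

Variables (T : modal_form P -> Prop) (thT : theory T).
Hypothesis K4T : forall x, K4_provable x -> T x.

Lemma B_eps_proj x y : T (B_eps x y) ->
  [/\ T x, T (MBox (m_imp x y)) & T (m_imp y (MBox (m_imp y x)))].
Proof. by case/(conj_proj thT) => /(conj_proj thT)[]. Qed.

Lemma B_eps_intro x y :
  T x -> T (MBox (m_imp x y)) -> T (m_imp y (MBox (m_imp y x))) ->
  T (B_eps x y).
Proof. by move=> ? ? ?; do 2?apply: (conj_intro thT). Qed.

(** Necessitation may fail in [T], so the boxed syllogism is derived in K4 and imported. *)
Lemma box_imp_trans x y z :
  T (MBox (m_imp x y)) -> T (MBox (m_imp y z)) -> T (MBox (m_imp x z)).
Proof.
move=> xy; apply: (cpl_theory_mp thT).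
by apply: (cpl_theory_mp thT) xy; exact/K4T/K4_box_trans.
Qed.

Lemma B_eps_ax1 x y : T (B_eps x y) -> T (B_eps x x).
Proof.
case/B_eps_proj=> Tx _ _; apply: B_eps_intro => //.
  exact/K4T/K4_box_refl.
by apply: (imp_weaken thT); exact/K4T/K4_box_refl.
Qed.

(** The second premise supplies [y], which detaches the box of [m_imp y x] from the last clause of
    the first. *)
Lemma B_eps_ax3 x y z : T (B_eps x y) -> T (B_eps y z) -> T (B_eps y x).
Proof.
case/B_eps_proj=> Tx xy yx /B_eps_proj[Ty _ _]; apply: B_eps_intro => //.
  exact: (cpl_theory_mp thT) yx Ty.
exact: (imp_weaken thT).
Qed.

End K4Theory.

Lemma B_eps_ax2 (T : modal_form P -> Prop) x y z : theory T ->
  (forall t, K4_provable t -> T t) ->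
  T (B_eps x y) -> T (B_eps y z) -> T (B_eps x z).
Proof.
move=> thT K4T /(B_eps_proj thT)[Tx xy yx] /(B_eps_proj thT)[Ty yz zy].
apply: (B_eps_intro thT) => //; first exact: box_imp_trans xy yz.
have thTz := extend_theory thT z.
(* Under the hypothesis [z], the clause [zy] is by conversion the box of [m_imp z y]; it is composed
   with the box of [m_imp y x], detached by [Ty]. *)
apply: (imp_of_extend (T := T)); apply: (box_imp_trans thTz) zy _.
  by move=> t /K4T; exact: extend_weaken.
by apply: (extend_weaken _ thT); exact: (cpl_theory_mp thT) yx Ty.
Qed.

End Soundness.

Lemma B_translation_provable (N P : Type) (p : N -> P) (phi : l1_form N) :
  L1_provable phi -> K4_provable (B_translation p phi).
Proof.
have thK := K4_theory P.
pose ext h := extend (@MNeg P) (@MOr P) (@K4_provable P) h.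
have thE h : cpl_theory (@MNeg P) (@MOr P) (ext h) := extend_theory thK h.
have weak h x : K4_provable x -> ext h x by exact: extend_weaken.
have self h : ext h h := extend_self h thK.
elim=> {phi} [x ax|a b|a b c|a b c|x y _ IHxy _ IHx].
- by case: ax => *; apply: K4_cpl; constructor.
(* The translated implication is, by conversion, membership of its conclusion in K4 extended by its
   premise. *)
- change (ext (B_translation p (L1Eps a b)) (B_translation p (L1Eps a a))).
  exact: (B_eps_ax1 (thE _) (weak _) (self _)).
- set h := B_translation p (l1_and (L1Eps a b) (L1Eps b c)).
  have [ab bc] := conj_proj (thE h) (self h).
  change (ext h (B_translation p (L1Eps a c))).
  exact: (B_eps_ax2 (thE h) (weak h) ab bc).
- set h := B_translation p (l1_and (L1Eps a b) (L1Eps b c)).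
  have [ab bc] := conj_proj (thE h) (self h).
  change (ext h (B_translation p (L1Eps b a))).
  exact: (B_eps_ax3 (thE h) ab bc).
- exact: K4_mp IHxy IHx.
Qed.

Theorem corollary6p5 (N P : Type)
    (hN : countably_infinite N) (hP : countably_infinite P)
    (p : N -> P) (hp : injective p) (phi : l1_form N) :
  L1_provable phi <-> K4_provable (B_translation p phi).
Proof.
split; first exact: B_translation_provable.
move=> Kphi; apply: L1_complete => v hv; apply/(star_forces_B hp hv).
exact: K4_sound (@star_rel_trans N) Kphi _ _.
Qed.
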